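(* Let $\mathcal{M}$ be an ergodic (not necessarily reversible) Markov chain on a finite state space $\Omega$ with stationary distribution $\pi$, and let $\mathcal{M}'$ be another ergodic (not necessarily reversible) Markov chain on $\Omega$ with the same stationary distribution. Let $f$ be an $(\mathcal{M},\mathcal{M}')$-flow. Then for every $\varepsilon>0$ and $x\in\Omega$, $$\tau_x(\widetilde{\mathcal{M}},\varepsilon)\ \le\ 4A(f)\,\frac{\tau(\widetilde{\mathcal{M}'},\frac{1}{2e})^2}{(\frac12-\frac1{2e})^2}\ln\left(\frac{1}{\varepsilon^2\pi(x)}\right)$$ and $$\tau_x(\widetilde{\mathcal{M}},\varepsilon)\ \le\ 4A(f)\,\frac{\tau(\mathcal{M}',\frac{1}{2e})^2}{(\frac12-\frac1{2e})^2}\ln\left(\frac{1}{\varepsilon^2\pi(x)}\right).$$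
   Context: A (discrete-time) Markov chain on a finite state space $\Omega$ with transition matrix $P$ is ergodic if irreducible and aperiodic; it then has a unique stationary distribution $\pi>0$. Variation distance: $\|\theta_1-\theta_2\|=\frac12\sum_i|\theta_1(i)-\theta_2(i)|$. Discrete mixing time: $\tau_x(\mathcal{M},\varepsilon)=\min\{t>0 \text{ integer}: \|P^{t'}(x,\cdot)-\pi\|\le\varepsilon \ \forall t'\ge t\}$, $\tau(\mathcal{M},\varepsilon)=\max_x\tau_x(\mathcal{M},\varepsilon)$. Continuization $\widetilde{\mathcal{M}}$: with $Q=P-I$, time-$t$ transition matrix $\exp(Qt)$; $\tau_x(\widetilde{\mathcal{M}},\varepsilon)=\inf\{t>0: \|v_x\exp(Qt')-\pi\|\le\varepsilon \ \forall \text{ real } t'\ge t\}$ ($v_x$ the unit row vector at $x$), $\tau(\widetilde{\mathcal{M}},\varepsilon)=\max_x\tau_x(\widetilde{\mathcal{M}},\varepsilon)$. Flows: Let $\mathcal{M}$ have transition matrix $P$ and stationary distribution $\pi$, and $\mathcal{M}'$ have transition matrix $P'$ and stationary distribution $\pi'$. Let $E^*(\mathcal{M})=\{(x,y): P(x,y)>0\}$ (pairs not necessarily distinct), similarly $E^*(\mathcal{M}')$. For $(x,y)\in E^*(\mathcal{M}')$, $\mathcal{P}_{x,y}$ is the set of paths $\gamma=(x=x_0,\dots,x_k=y)$ with each $(x_i,x_{i+1})\in E^*(\mathcal{M})$ and each $(z,w)\in E^*(\mathcal{M})$ appearing at most twice as a consecutive pair on $\gamma$; $|\gamma|=k$. $\mathcal{P}=\bigcup_{(x,y)\in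 E^*(\mathcal{M}')}\mathcal{P}_{x,y}$. An $(\mathcal{M},\mathcal{M}')$-flow is $f:\mathcal{P}\to[0,1]$ with $\sum_{\gamma\in\mathcal{P}_{x,y}}f(\gamma)=\pi'(x)P'(x,y)$ for all $(x,y)\in E^*(\mathcal{M}')$. With $r((z,w),\gamma)$ the number of times $(z,w)$ appears on $\gamma$, $A_{z,w}(f)=\frac{1}{\pi(z)P(z,w)}\sum_{\gamma:(z,w)\in\gamma}r((z,w),\gamma)|\gamma|f(\gamma)$ and $A(f)=\max_{(z,w)\in E^*(\mathcal{M})}A_{z,w}(f)$.
   Formalization: The formal theorem assumes in addition that ε²π(x) ≤ 1; for larger ε the claim fails on any chain with at least two states, since τ_x is then 0 while the logarithm makes the right-hand side negative. *)

(* Defs.v *)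
From HB Require Import structures.
From mathcomp Require Import all_boot all_order all_algebra.
From mathcomp Require Import all_classical all_reals all_analysis.
Set Implicit Arguments. Unset Strict Implicit. Unset Printing Implicit Defensive.
Import Order.TTheory GRing.Theory Num.Theory.
Import numFieldNormedType.Exports.
Local Open Scope ring_scope.
Local Open Scope classical_set_scope.

Section MarkovDefs.
Variables (R : realType) (n : nat).
Implicit Types (P Q : 'M[R]_n) (pi : 'rV[R]_n) (x y z w : 'I_n).

Definition stochastic P :=
  (forall x y, 0 <= P x y) /\ (forall x, \sum_y P x y = 1).

Definition irreducible P := forall x y, exists t : nat, 0 < (P ^+ t) x y.

Definition aperiodic P :=
  forall x (d : nat),
    (forall t : nat, (0 < t)%N -> 0 < (P ^+ t) x x -> (d %| t)%N) -> d = 1%N.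

Definition ergodic P := [/\ stochastic P, irreducible P & aperiodic P].

Definition distribution pi := (forall x, 0 <= pi 0 x) /\ \sum_x pi 0 x = 1.

Definition stationary P pi := distribution pi /\ pi *m P = pi.

Definition tvdist (u v : 'rV[R]_n) : R := 2^-1 * \sum_i `|u 0 i - v 0 i|.

(* tau_x(M,eps) = min{ t > 0 integer : forall t' >= t, ||P^t'(x,.) - pi|| <= eps }
   (the infimum of this set of positive integers, which is its minimum
   whenever it is nonempty, as it is for ergodic chains) *)
Definition mix_time_x P pi (eps : R) x : R :=
  inf [set (t%:R : R) | t in
        [set t : nat | (0 < t)%N /\
          forall t' : nat, (t <= t')%N -> tvdist (row x (P ^+ t')) pi <= eps]].

Definition mix_time P pi (eps : R) : R :=
  \big[Num.max/0]_x mix_time_x P pi eps x.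

Definition expmx (M : 'M[R]_n) : 'M[R]_n :=
  \matrix_(i, j) limn (series (fun k : nat => (M ^+ k) i j / (k`!)%:R : R)).

Definition cont_kernel P (t : R) : 'M[R]_n := expmx (t *: (P - 1%:M)).

Definition cmix_time_x P pi (eps : R) x : R :=
  inf [set t : R | 0 < t /\
        forall t' : R, t <= t' -> tvdist (row x (cont_kernel P t')) pi <= eps].

Definition cmix_time P pi (eps : R) : R :=
  \big[Num.max/0]_x cmix_time_x P pi eps x.

Definition path_edges (g : seq 'I_n) : seq ('I_n * 'I_n) := zip g (behead g).

Definition path_len (g : seq 'I_n) : nat := size (path_edges g).

Definition occ (e : 'I_n * 'I_n) (g : seq 'I_n) : nat := count_mem e (path_edges g).

Definition is_Mpath P (g : seq 'I_n) : bool :=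
  [&& (0 < size g)%N,
      all (fun e => 0 < P e.1 e.2) (path_edges g)
    & all (fun e => (occ e g <= 2)%N) (path_edges g)].

Definition in_paths P P' (g : seq 'I_n) : bool :=
  if g is x0 :: g' then is_Mpath P g && (0 < P' x0 (last x0 g')) else false.

Definition path_from_to (x y : 'I_n) (g : seq 'I_n) : bool :=
  if g is x0 :: g' then (x0 == x) && (last x0 g' == y) else false.

Fixpoint all_seqs (L : nat) : seq (seq 'I_n) :=
  if L is L'.+1 then [::] :: [seq x :: s | x <- enum 'I_n, s <- all_seqs L']
  else [:: [::]].

(* Any path of M has at most 2 n^2 edges (each of the <= n^2 pairs occurs at
   most twice), hence size <= 2 n^2 + 1; so this finite duplicate-free list
   enumerates the (finite) set \mathcal P. *)
Definition path_list P P' : seq (seq 'I_n) :=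
  [seq g <- undup (all_seqs (2 * n * n).+1) | in_paths P P' g].

(* (M,M')-flow: f : \mathcal P -> [0,1] (values of f outside \mathcal P are
   irrelevant) with sum_{gamma in P_{x,y}} f(gamma) = pi'(x) P'(x,y). *)
Definition is_flow P P' (pi' : 'rV[R]_n) (f : seq 'I_n -> R) :=
  (forall g, in_paths P P' g -> 0 <= f g <= 1) /\
  (forall x y, 0 < P' x y ->
     \sum_(g <- path_list P P' | path_from_to x y g) f g = pi' 0 x * P' x y).

Definition congestion_edge P P' pi (f : seq 'I_n -> R) (z w : 'I_n) : R :=
  (pi 0 z * P z w)^-1 *
  \sum_(g <- path_list P P' | (z, w) \in path_edges g)
     (occ (z, w) g)%:R * (path_len g)%:R * f g.

Definition congestion P P' pi (f : seq 'I_n -> R) : R :=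
  \big[Num.max/0]_(z | true) \big[Num.max/0]_(w | 0 < P z w)
     congestion_edge P P' pi f z w.

End MarkovDefs.

(* Main.v *)
(* For a kernel K with invariant law pi put
   E_K(phi) = sum_(x,y) pi(x) K(x,y) (phi(x) - phi(y))^2, and let V be the same
   form for the kernel whose rows all equal pi.

   The rows of exp(t(P - 1)) have chi-square distance to pi decaying at rate
   2 / C as soon as V <= C E_P, and a flow gives E_P' <= A(f) E_P, by
   Cauchy-Schwarz along the paths.  It remains to bound V by E_P', which is done
   without conductance or Cheeger's inequality: if every row of K is within
   1/(2e) of pi, a Schur test gives (1/2 - 1/e) V <= E_K; this is applied to
   K = P'^t or exp(t(P' - 1)).  Decomposing the increment over t steps into
   one-step increments, Minkowski gives E_K <= t^2 E_P' in discrete time and,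
   the number of steps being Poisson, E_K <= (t^2 + t) E_P' in continuous time.
   The constant 4 of the theorem leaves ample room for the numerical losses.

   Convergence to pi is needed only because the infimum defining a mixing time
   is 0 on the empty set. *)
Require Import Defs.
From HB Require Import structures.
From mathcomp Require Import all_boot all_order all_algebra.
From mathcomp Require Import all_classical all_reals all_analysis.
From mathcomp Require Import zify ring lra.
Import Order.TTheory GRing.Theory Num.Theory.
Import numFieldNormedType.Exports.
Local Open Scope ring_scope.

Set Implicit Arguments.
Unset Strict Implicit.
Unset Printing Implicit Defensive.

(** * Dirichlet forms of stationary kernels and their comparison with the variance *)

Section DirichletForm.
Variables (R : realType) (n : nat) (pi : 'rV[R]_n).
Hypothesis pi_distr : Defs.distribution pi.
Implicit Types (K P : 'M[R]_n) (phi : 'I_n -> R) (x y z : 'I_n).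

(** The form sees only the additive symmetrization of [K], so chains that are not reversible need no
    separate treatment. With no factor 1/2, the form of [equilibrium] is twice the variance under
    [pi]. *)
Definition dform K phi : R :=
  \sum_x \sum_y pi 0 x * K x y * (phi x - phi y) ^+ 2.

Definition equilibrium : 'M[R]_n := \matrix_(x, y) pi 0 y.

Let pi_ge0 x : 0 <= pi 0 x. Proof. by case: pi_distr. Qed.
Let pi_sum : \sum_x pi 0 x = 1. Proof. by case: pi_distr. Qed.

Lemma equilibrium_stochastic : stochastic equilibrium.
Proof.
split=> [x y|x]; first by rewrite mxE.
by under eq_bigr do rewrite mxE.
Qed.

Lemma stationaryP K : pi *m K = pi <-> forall y, \sum_x pi 0 x * K x y = pi 0 y.
Proof.
split=> [h y|h]; first by rewrite -[in RHS]h mxE.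
by apply/rowP => y; rewrite mxE h.
Qed.

Lemma equilibrium_stationary : pi *m equilibrium = pi.
Proof.
apply/stationaryP => y; under eq_bigr do rewrite mxE.
by rewrite -mulr_suml pi_sum mul1r.
Qed.

Lemma sum_cst_stochastic K (h : 'I_n -> R) : stochastic K ->
  \sum_x \sum_y pi 0 x * K x y * h x = \sum_x pi 0 x * h x.
Proof.
move=> [_ K1]; apply: eq_bigr => x _.
by rewrite -mulr_suml -mulr_sumr K1 mulr1.
Qed.

Lemma sum_cst_stationary K (h : 'I_n -> R) : pi *m K = pi ->
  \sum_x \sum_y pi 0 x * K x y * h y = \sum_y pi 0 y * h y.
Proof.
move=> /stationaryP piK; rewrite exchange_big /=; apply: eq_bigr => y _.
by rewrite -mulr_suml piK.
Qed.

(** Both marginals of the weights [pi 0 x * K x y] are [pi]: the first because rows sum to 1, the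
    second by stationarity. *)
Lemma dform_expand K phi : stochastic K -> pi *m K = pi ->
  dform K phi = 2 * (\sum_x pi 0 x * phi x ^+ 2)
                - 2 * \sum_x \sum_y pi 0 x * K x y * (phi x * phi y).
Proof.
move=> sK piK.
rewrite [2 * (\sum_x _ * _)]mulr_natl mulr2n.
rewrite -{1}(sum_cst_stochastic (fun x => phi x ^+ 2) sK).
rewrite -(sum_cst_stationary (fun x => phi x ^+ 2) piK).
rewrite -big_split mulr_sumr -sumrB; apply: eq_bigr => x _.
rewrite -big_split mulr_sumr -sumrB; apply: eq_bigr => y _ /=.
ring.
Qed.

Lemma dform_shift K phi c : dform K (fun x => phi x - c) = dform K phi.
Proof.
apply: eq_bigr => x _; apply: eq_bigr => y _; congr (_ * _).
by rewrite opprB addrA subrK.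
Qed.

Lemma dform_ge0 K phi : (forall x y, 0 <= K x y) -> 0 <= dform K phi.
Proof.
move=> K0; apply: sumr_ge0 => x _; apply: sumr_ge0 => y _.
by rewrite mulr_ge0 ?sqr_ge0 ?mulr_ge0.
Qed.

Lemma dvar_expand phi : dform equilibrium phi =
  2 * (\sum_x pi 0 x * phi x ^+ 2) - 2 * (\sum_x pi 0 x * phi x) ^+ 2.
Proof.
rewrite (dform_expand _ equilibrium_stochastic equilibrium_stationary).
congr (_ - _ * _); rewrite expr2 mulr_suml; apply: eq_bigr => x _.
rewrite mulr_sumr; apply: eq_bigr => y _; rewrite mxE; ring.
Qed.

(** On centered functions [K] may be replaced by [K - equilibrium]. In absolute value this matrix
    has row sums at most [a]; its columns, weighted by [pi], get only the trivial bound
    [2 * pi 0 y], which the weight 1/4 below turns into 1/2. *)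
Lemma dform_tv_centered K phi (a : R) : stochastic K -> pi *m K = pi ->
  (forall x, \sum_y `|K x y - pi 0 y| <= a) ->
  \sum_x pi 0 x * phi x = 0 ->
  (2^-1 - a) * dform equilibrium phi <= dform K phi.
Proof.
move=> sK piK Ka phi0.
rewrite dvar_expand (dform_expand _ sK piK) phi0.
set S := \sum_x pi 0 x * phi x ^+ 2.
suff : \sum_x \sum_y pi 0 x * K x y * (phi x * phi y) <= (a + 2^-1) * S by lra.
have -> : \sum_x \sum_y pi 0 x * K x y * (phi x * phi y) =
    \sum_x \sum_y pi 0 x * (K x y - pi 0 y) * (phi x * phi y).
  apply: eq_bigr => x _.
  transitivity (\sum_y pi 0 x * K x y * (phi x * phi y)
                - pi 0 x * phi x * \sum_y pi 0 y * phi y).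
    by rewrite phi0 mulr0 subr0.
  by rewrite mulr_sumr -sumrB; apply: eq_bigr => y _; ring.
(* AM-GM with weight 2: [phi x * phi y <= phi x ^+ 2 + phi y ^+ 2 / 4] *)
apply: (@le_trans _ _ (\sum_x \sum_y pi 0 x * `|K x y - pi 0 y| * phi x ^+ 2 +
    4^-1 * \sum_x \sum_y pi 0 x * `|K x y - pi 0 y| * phi y ^+ 2)).
  rewrite mulr_sumr -big_split; apply: ler_sum => x _ /=.
  rewrite mulr_sumr -big_split; apply: ler_sum => y _ /=.
  set D := K x y - pi 0 y; set p := pi 0 x.
  have p0 : 0 <= p by exact: pi_ge0.
  have -> : p * `|D| * phi x ^+ 2 + 4^-1 * (p * `|D| * phi y ^+ 2) =
     p * (`|D| * (phi x ^+ 2 + 4^-1 * phi y ^+ 2)) by ring.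
  rewrite -mulrA; apply: ler_wpM2l => //.
  apply: (le_trans (ler_norm _)); rewrite normrM; apply: ler_wpM2l => //.
  rewrite ler_norml; have := sqr_ge0 (phi x - 2^-1 * phi y).
  have := sqr_ge0 (phi x + 2^-1 * phi y).
  rewrite !expr2; nra.
rewrite mulrDl; apply: lerD.
  rewrite /S mulr_sumr; apply: ler_sum => x _.
  rewrite -mulr_suml -mulr_sumr mulrAC mulrC; apply: ler_wpM2r => //.
  by rewrite mulr_ge0 ?sqr_ge0.
rewrite (_ : 2^-1 * S = 4^-1 * (2 * S)); last by field.
apply: ler_wpM2l; first by rewrite invr_ge0.
rewrite exchange_big /S mulr_sumr; apply: ler_sum => y _ /=.
rewrite -mulr_suml mulrA; apply: ler_wpM2r; first exact: sqr_ge0.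
apply: (@le_trans _ _ (\sum_x (pi 0 x * K x y + pi 0 x * pi 0 y))).
  apply: ler_sum => x _; rewrite -mulrDr; apply: ler_wpM2l => //.
  apply: (le_trans (ler_normB _ _)).
  by rewrite !ger0_norm//; case: sK => /(_ x y).
rewrite big_split /=; move/stationaryP: piK => ->.
by rewrite -mulr_suml pi_sum; lra.
Qed.

Lemma dform_tv K phi (a : R) : stochastic K -> pi *m K = pi ->
  (forall x, \sum_y `|K x y - pi 0 y| <= a) ->
  (2^-1 - a) * dform equilibrium phi <= dform K phi.
Proof.
move=> sK piK Ka; set m := \sum_x pi 0 x * phi x.
rewrite -(dform_shift _ _ m) -(dform_shift K _ m).
apply: dform_tv_centered => //.
under eq_bigr do rewrite mulrBr.
by rewrite sumrB -mulr_suml pi_sum mul1r subrr.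
Qed.

Lemma stochasticM K P : stochastic K -> stochastic P -> stochastic (K *m P).
Proof.
move=> [K0 K1] [P0 P1]; split=> [x y|x].
  by rewrite mxE; apply: sumr_ge0 => z _; rewrite mulr_ge0.
under eq_bigr do rewrite mxE.
rewrite exchange_big /= -[RHS](K1 x); apply: eq_bigr => z _.
by rewrite -mulr_sumr P1 mulr1.
Qed.

Lemma stochasticX P k : stochastic P -> stochastic (P ^+ k).
Proof.
move=> sP; elim: k => [|k IHk]; last by rewrite exprSr; exact: stochasticM.
split=> [x y|x]; first by rewrite expr0 mxE ler0n.
rewrite (bigD1 x)//= big1 => [|y /negPf yx]; rewrite expr0 mxE ?eqxx ?addr0//.
by rewrite eq_sym yx.
Qed.

Lemma stationaryX P k : pi *m P = pi -> pi *m (P ^+ k) = pi.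
Proof.
move=> piP; elim: k => [|k IHk]; first by rewrite expr0 mulmx1.
by rewrite exprSr mulmxA IHk.
Qed.

(* Minkowski: [sqrt (dform K phi)] is the L2 norm of the increment of [phi]
   over one step of the stationary chain with kernel [K]. *)
Lemma dformX P phi k : stochastic P -> pi *m P = pi ->
  dform (P ^+ k) phi <= k%:R ^+ 2 * dform P phi.
Proof.
move=> sP piP; elim: k => [|k IHk].
  rewrite expr0n mul0r /dform big1// => x _; rewrite big1// => y _.
  rewrite expr0 mxE; case: eqP => [->|_]; last by rewrite mulr0 mul0r.
  by rewrite subrr expr0n mulr0.
have [->|k0] := eqVneq k 0%N; first by rewrite expr1 expr1n mul1r.
have {}k0 : 0 < k%:R :> R by rewrite ltr0n lt0n.
have sPk := stochasticX k sP.
have piPk := stationaryX k piP.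
set c : R := k%:R in IHk k0 *.
(* The weight [c = k] closes the induction exactly: [(1 + 1/k) k^2 + (1 + k) = (k + 1)^2]. All three
   forms are then written over triples [x], [y], [z]: [k] steps followed by one. *)
apply: (@le_trans _ _ ((1 + c^-1) * dform (P ^+ k) phi + (1 + c) * dform P phi)).
  have -> : dform (P ^+ k.+1) phi = \sum_x \sum_y \sum_z
      pi 0 x * (P ^+ k) x y * P y z * (phi x - phi z) ^+ 2.
    apply: eq_bigr => x _; rewrite exchange_big /=; apply: eq_bigr => z _.
    rewrite exprSr mxE mulr_sumr mulr_suml; apply: eq_bigr => y _.
    by rewrite mulrA.
  have -> : dform (P ^+ k) phi = \sum_x \sum_y \sum_z
      pi 0 x * (P ^+ k) x y * P y z * (phi x - phi y) ^+ 2.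
    apply: eq_bigr => x _; apply: eq_bigr => y _.
    by rewrite -mulr_suml -mulr_sumr; case: sP => _ ->; rewrite mulr1.
  have -> : dform P phi = \sum_x \sum_y \sum_z
      pi 0 x * (P ^+ k) x y * P y z * (phi y - phi z) ^+ 2.
    rewrite [RHS]exchange_big /=; apply: eq_bigr => y _.
    rewrite exchange_big /=; apply: eq_bigr => z _.
    rewrite -mulr_suml -mulr_suml.
    by move/stationaryP: piPk => ->.
  rewrite !mulr_sumr -big_split; apply: ler_sum => x _ /=.
  rewrite !mulr_sumr -big_split; apply: ler_sum => y _ /=.
  rewrite !mulr_sumr -big_split; apply: ler_sum => z _ /=.
  set w := pi 0 x * _ * _.
  have w0 : 0 <= w.
    by rewrite !mulr_ge0//; [case: sPk|case: sP].
  rewrite !(mulrCA _ w) -mulrDr; apply: ler_wpM2l => //.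
  set p := phi x - phi y; set q := phi y - phi z.
  have -> : phi x - phi z = p + q by rewrite /p /q addrA subrK.
  rewrite -subr_ge0.
  have -> : (1 + c^-1) * p ^+ 2 + (1 + c) * q ^+ 2 - (p + q) ^+ 2 =
     c^-1 * (p - c * q) ^+ 2 by field; rewrite gt_eqF.
  by rewrite mulr_ge0 ?sqr_ge0 ?invr_ge0 ?ltW.
rewrite -natr1 -/c.
apply: (@le_trans _ _ ((1 + c^-1) * (c ^+ 2 * dform P phi) + (1 + c) * dform P phi)).
  by rewrite lerD2r ler_wpM2l// addr_ge0 ?invr_ge0 ?ltW.
rewrite le_eqVlt; apply/orP; left; apply/eqP; field.
by rewrite gt_eqF.
Qed.

End DirichletForm.

(** * Comparison of two Dirichlet forms along a flow *)

Section Flow.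
Variables (R : realType) (n : nat).
Implicit Types (P : 'M[R]_n) (phi : 'I_n -> R) (x y z w : 'I_n).

(** Cauchy-Schwarz for the telescoping sum of increments along the path, by induction; the one-edge
    path is treated apart because the induction step divides by the length of the tail. *)
Lemma sqr_telescope_path phi x (s : seq 'I_n) :
  (phi x - phi (last x s)) ^+ 2 <= (path_len (x :: s))%:R *
    \sum_(e <- path_edges (x :: s)) (phi e.1 - phi e.2) ^+ 2.
Proof.
elim: s x => [|y s IHs] x.
  by rewrite /path_len /path_edges /= big_nil subrr expr0n mulr0.
rewrite [last x (y :: s)]/= /path_len [path_edges _]/= big_cons.
rewrite [size _]/= -/(path_edges (y :: s)) -/(path_len (y :: s)).
move: IHs => /(_ y).
set S := \sum_(e <- _) _; set l := path_len _.
have S0 : 0 <= S by apply: sumr_ge0 => e _; exact: sqr_ge0.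
have -> : phi x - phi (last y s) = (phi x - phi y) + (phi y - phi (last y s)).
  by rewrite addrA subrK.
set p := phi x - phi y; set q := phi y - _ => qS /=.
rewrite -natr1.
have [l0|l0] := eqVneq l 0%N.
  move: qS; rewrite l0 mul0r add0r mul1r => q0.
  have /eqP : q ^+ 2 = 0 by apply/eqP; rewrite eq_le q0 sqr_ge0.
  by rewrite sqrf_eq0 => /eqP ->; rewrite addr0 lerDl.
have {}l0 : 0 < l%:R :> R by rewrite ltr0n lt0n.
move: qS l0; set c : R := l%:R => qS l0.
rewrite -subr_ge0.
have -> : (c + 1) * (p ^+ 2 + S) - (p + q) ^+ 2 =
   c^-1 * ((c * p - q) ^+ 2 + (c + 1) * (c * S - q ^+ 2)).
  by field; rewrite gt_eqF.
apply: mulr_ge0; first by rewrite invr_ge0 ltW.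
apply: addr_ge0; first exact: sqr_ge0.
by apply: mulr_ge0; [rewrite addr_ge0 ?ltW|rewrite subr_ge0].
Qed.

Lemma sum_path_edges (F : 'I_n -> 'I_n -> R) (g : seq 'I_n) :
  \sum_(e <- path_edges g) F e.1 e.2 = \sum_z \sum_w (occ (z, w) g)%:R * F z w.
Proof.
rewrite /occ pair_big /=; elim: (path_edges g) => [|e s IHs].
  by rewrite big_nil big1// => e _; rewrite mul0r.
rewrite big_cons IHs.
have -> : F e.1 e.2 = \sum_p (e == p)%:R * F p.1 p.2.
  rewrite (bigD1 e)//= eqxx mul1r big1 ?addr0// => p /negPf.
  by rewrite eq_sym => ->; rewrite mul0r.
rewrite -big_split; apply: eq_bigr => -[z w] _ /=.
by rewrite natrD mulrDl.
Qed.

Lemma mem_path_list P P' g : g \in path_list P P' -> in_paths P P' g.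
Proof. by rewrite mem_filter => /andP[]. Qed.

Lemma occ_path0 P P' g z w : in_paths P P' g -> P z w <= 0 -> occ (z, w) g = 0%N.
Proof.
case: g => // x0 g /andP[/and3P[_ /allP edges _] _] Pzw.
apply/count_memPn; apply/negP => /edges /=.
by rewrite ltNge Pzw.
Qed.

Lemma congestion_ge P P' pi (f : seq 'I_n -> R) z w : 0 < P z w ->
  congestion_edge P P' pi f z w <= congestion P P' pi f.
Proof.
move=> Pzw; apply: le_trans (le_bigmax_cond _ _ (isT : true)).
exact: (le_bigmax_cond _ (fun w => congestion_edge P P' pi f z w)).
Qed.

Lemma congestion_ge0 P P' pi (f : seq 'I_n -> R) : 0 <= congestion P P' pi f.
Proof. exact: bigmax_ge_id. Qed.

(** The flow spreads the weight [pi 0 x * P' x y] over the paths from [x] to [y]. After the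
    telescoping bound and an exchange of sums, the coefficient of [(phi z - phi w) ^+ 2] is [W z w],
    the numerator of the congestion of the edge. *)
Lemma dform_flow P P' (pi : 'rV[R]_n) (f : seq 'I_n -> R) phi :
  (forall x y, 0 <= P x y) -> (forall x y, 0 <= P' x y) ->
  (forall x, 0 < pi 0 x) -> is_flow P P' pi f ->
  dform pi P' phi <= congestion P P' pi f * dform pi P phi.
Proof.
move=> P_ge0 P'_ge0 pi_gt0 [f01 fP'].
pose d z w := (phi z - phi w) ^+ 2.
have f0 g : g \in path_list P P' -> 0 <= f g.
  by move=> /mem_path_list /f01 /andP[].
have -> : dform pi P' phi = \sum_(g <- path_list P P')
    \sum_x \sum_y (if path_from_to x y g then f g * d x y else 0).
  rewrite exchange_big; apply: eq_bigr => x _ /=.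
  rewrite exchange_big; apply: eq_bigr => y _ /=.
  rewrite -big_mkcond /= -mulr_suml.
  (* A pair of zero [P'] probability is joined by no path of [path_list], so both sides vanish. *)
  have [P'0|P'0] := ltrP 0 (P' x y); first by rewrite fP'.
  have -> : P' x y = 0 by apply/eqP; rewrite eq_le P'0 P'_ge0.
  rewrite mulr0 big_seq_cond big1// => -[|x0 g] /andP[/mem_path_list]//=.
  move=> /andP[_ P'g] /andP[/eqP gx /eqP gy].
  by move: P'g; rewrite gy gx ltNge P'0.
pose W z w := \sum_(g <- path_list P P') (occ (z, w) g)%:R * (path_len g)%:R * f g.
apply: (@le_trans _ _ (\sum_z \sum_w W z w * d z w)).
  have -> : \sum_z \sum_w W z w * d z w = \sum_(g <- path_list P P')
      f g * ((path_len g)%:R * \sum_z \sum_w (occ (z, w) g)%:R * d z w).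
    rewrite [RHS](eq_bigr (fun g => \sum_z \sum_w
       (occ (z, w) g)%:R * (path_len g)%:R * f g * d z w)); last first.
      move=> g _; rewrite mulrA mulr_sumr; apply: eq_bigr => z _.
      by rewrite mulr_sumr; apply: eq_bigr => w _; ring.
    rewrite [RHS]exchange_big; apply: eq_bigr => z _ /=.
    rewrite [RHS]exchange_big; apply: eq_bigr => w _ /=.
    by rewrite mulr_suml.
  rewrite big_seq [leRHS]big_seq; apply: ler_sum => g gP.
  case: g gP => [/mem_path_list//|x0 g] gP.
  (* A path has a single pair of endpoints, so the double sum collapses to one term. *)
  rewrite (bigD1 x0)//= [X in _ + X]big1 ?addr0; last first.
    move=> x /negPf xx0; rewrite big1// => y _; by rewrite eq_sym xx0.
  rewrite (bigD1 (last x0 g))//= !eqxx big1 ?addr0; last first.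
    by move=> y /negPf yl; rewrite eq_sym yl.
  apply: ler_wpM2l; first exact: f0.
  rewrite -(sum_path_edges d); exact: sqr_telescope_path.
rewrite mulr_sumr; apply: ler_sum => z _.
rewrite mulr_sumr; apply: ler_sum => w _.
rewrite mulrA; apply: ler_wpM2r; first exact: sqr_ge0.
have [P0|P0] := ltrP 0 (P z w); last first.
  rewrite /W big_seq big1 => [|g /mem_path_list gP].
    by rewrite mulr_ge0 ?congestion_ge0// mulr_ge0 ?P_ge0 ?(ltW (pi_gt0 z)).
  by rewrite (occ_path0 gP P0) !mul0r.
have pP : 0 < pi 0 z * P z w by rewrite mulr_gt0.
rewrite -ler_pdivrMr//; apply: le_trans (congestion_ge P' pi f P0).
rewrite /congestion_edge mulrC ler_pM2l ?invr_gt0//.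
rewrite [leRHS]big_mkcond; apply: ler_sum => g _; case: ifPn => //.
by move=> /count_memPn; rewrite /occ => ->; rewrite !mul0r.
Qed.

End Flow.

(** * Entries of the matrix exponential as power series in time *)

Section MatrixExponential.
Local Open Scope classical_set_scope.
Variables (R : realType) (n : nat).
Implicit Types (A P : 'M[R]_n) (i j l : 'I_n) (t : R).

Lemma is_derive_bigsum (h : 'I_n -> R -> R) (dh : 'I_n -> R) t :
  (forall i, is_derive t 1 (h i) (dh i)) ->
  is_derive t 1 (fun s => \sum_i h i s) (\sum_i dh i).
Proof.
move=> dhP; rewrite (_ : (fun s => _) = \sum_i h i); first exact: is_derive_sum.
by apply/funext => s; rewrite fct_sumE.
Qed.

Lemma is_derive_mulf (g h : R -> R) (dg dh t : R) :
  is_derive t 1 g dg -> is_derive t 1 h dh ->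
  is_derive t 1 (fun s => g s * h s) (g t * dh + h t * dg).
Proof. by move=> *; exact: is_deriveM. Qed.

Lemma is_derive_mulfr (g : R -> R) (dg c t : R) :
  is_derive t 1 g dg -> is_derive t 1 (fun s => g s * c) (dg * c).
Proof.
move=> gd; have := is_derive_mulf gd (@is_derive_cst _ _ _ c t 1).
by rewrite mulr0 add0r mulrC.
Qed.

Lemma is_derive_expR_scale (c t : R) :
  is_derive t 1 (fun s => expR (c * s)) (c * expR (c * t)).
Proof.
have dc : is_derive t (1 : R) (c *: (@id R) : R -> R) c.
  by apply: is_derive_eq; rewrite scaler1.
have := @is_derive1_comp _ expR (c *: (@id R) : R -> R) t _ _ (is_derive_expR _) dc.
by rewrite mulrC.
Qed.

Lemma derive_le0_nonincreasing (g dg : R -> R) t :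
  (forall s : R, is_derive s (1 : R) g (dg s)) -> (forall s, 0 <= s -> dg s <= 0) -> 0 <= t ->
  g t <= g 0.
Proof.
move=> gdg dg0 t0.
have dv (s : R) : derivable g s 1 by [].
apply: (@ler0_derive1_le_cc _ g 0 t) => //; rewrite ?in_itv/= ?lexx ?t0//.
- by move=> s; rewrite in_itv => /andP[/ltW s0 _]; rewrite derive1E derive_val dg0.
- by apply: derivable_within_continuous.
Qed.

(** Comparison with [C] times an exponential series. The factor [C] leaves room for the shifted
    coefficients of the differentiated series. *)
Lemma cvg_pseries_fact (c : R^nat) (C M t : R) : 0 <= C -> 0 <= M ->
  (forall k, `|c k| <= C * M ^+ k) ->
  cvgn (pseries (fun k => c k / k`!%:R) t).
Proof.
move=> C0 M0 cM; apply: normed_cvg.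
apply: (series_le_cvg _ (v_ := fun k => C * exp_coeff (M * `|t|) k)).
- by move=> k; exact: normr_ge0.
- by move=> k; rewrite mulr_ge0// /exp_coeff /= mulr_ge0 ?invr_ge0 ?exprn_ge0 ?mulr_ge0.
- move=> k; rewrite /exp_coeff /= normrM normf_div normrX (ger0_norm (ler0n _ k`!)).
  rewrite mulrAC -mulrA exprMn -!mulrA [leRHS]mulrA.
  by apply: ler_wpM2r; rewrite ?mulr_ge0 ?invr_ge0 ?exprn_ge0.
- exact: (@is_cvg_seriesZ _ _ C (is_cvg_series_exp_coeff (M * `|t|))).
Qed.

Lemma pseries_diffs_fact (c : R^nat) :
  pseries_diffs (fun k => c k / k`!%:R) = (fun k => c k.+1 / k`!%:R).
Proof.
apply/funext => k; rewrite /pseries_diffs factS natrM.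
rewrite invfM mulrCA; congr (_ * _); rewrite mulrA divff ?mul1r//.
Qed.

Lemma mx_pow_bound A : exists2 M : R, 0 <= M &
  forall k i j, `|(A ^+ k) i j| <= M ^+ k.
Proof.
(* The entrywise l1 norm is submultiplicative and dominates every entry. *)
exists (\sum_i \sum_j `|A i j|).
  by apply: sumr_ge0 => i _; apply: sumr_ge0.
elim=> [|k IHk] i j.
  by rewrite expr0 mxE; case: eqP; rewrite ?normr1 ?normr0.
rewrite exprSr mxE; apply: (le_trans (ler_norm_sum _ _ _)).
rewrite exprSr mulr_sumr; apply: ler_sum => l _.
rewrite normrM; apply: ler_pM => //.
by rewrite (bigD1 j)//= lerDl sumr_ge0.
Qed.

Definition expmx_coef A i j : R^nat := fun k => (A ^+ k) i j / k`!%:R.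

Lemma cvg_expmx_coef A i j t : cvgn (pseries (expmx_coef A i j) t).
Proof.
have [M M0 AM] := mx_pow_bound A.
by apply: (@cvg_pseries_fact _ 1 M) => // k; rewrite mul1r.
Qed.

Lemma scalemxX A t k : (t *: A) ^+ k = t ^+ k *: A ^+ k.
Proof.
elim: k => [|k IHk]; first by rewrite !expr0 scale1r.
rewrite !exprSr IHk; change (t ^+ k *: A ^+ k *m (t *: A) = t ^+ k * t *: (A ^+ k *m A)).
by rewrite -scalemxAl -scalemxAr scalerA.
Qed.

Lemma expmxE A t i j : expmx (t *: A) i j = limn (pseries (expmx_coef A i j) t).
Proof.
rewrite mxE /pseries; congr (limn (series _)); apply/funext => k.
by rewrite /expmx_coef scalemxX mxE [RHS]mulrAC [t ^+ k * _]mulrC.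
Qed.

Lemma cvg_expmx A t i j :
  pseries (expmx_coef A i j) t @ \oo --> expmx (t *: A) i j.
Proof. by rewrite expmxE; exact: cvg_expmx_coef. Qed.

Lemma is_derive_expmx A i j t :
  is_derive t 1 (fun s => expmx (s *: A) i j)
    (\sum_l expmx (t *: A) i l * A l j).
Proof.
have [M M0 AM] := mx_pow_bound A.
have diffsE : pseries_diffs (expmx_coef A i j) =
    (fun k => (A ^+ k.+1) i j / k`!%:R) by exact: pseries_diffs_fact.
rewrite (_ : (fun s => _) = fun s => limn (pseries (expmx_coef A i j) s)); last first.
  by apply/funext => s; rewrite expmxE.
rewrite (_ : \sum_l _ = limn (pseries (pseries_diffs (expmx_coef A i j)) t)).
  (* Termwise differentiation asks for convergence of the series and of its first two formal
     derivatives at a point of modulus larger than that of [t]. *)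
  apply: (@pseries_snd_diffs _ _ (`|t| + 1)).
  - exact: cvg_expmx_coef.
  - rewrite diffsE; apply: (@cvg_pseries_fact _ M M) => // k.
    by rewrite -exprS.
  - rewrite diffsE (pseries_diffs_fact (fun k => (A ^+ k.+1) i j)).
    apply: (@cvg_pseries_fact _ (M ^+ 2) M) => [|//|k]; first exact: exprn_ge0.
    by rewrite -exprD.
  - by rewrite [ltRHS]ger0_norm// ltrDl.
apply/esym/cvg_lim => //.
rewrite (_ : pseries _ _ =
    fun m => \sum_l pseries (expmx_coef A i l) t m * A l j); last first.
  apply/funext => m; rewrite /pseries /series /=.
  rewrite [RHS](eq_bigr (fun l => \sum_(0 <= k < m)
    (A ^+ k) i l * A l j / k`!%:R * t ^+ k)); last first.
    move=> l _; rewrite mulr_suml; apply: eq_bigr => k _.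
    rewrite /expmx_coef; ring.
  rewrite exchange_big /=; apply: eq_bigr => k _.
  by rewrite diffsE exprSr mxE !mulr_suml.
apply: cvg_big => [|l _]; first exact: add_continuous.
by apply: cvgMl; exact: cvg_expmx.
Qed.

Lemma expmx0 A i j : expmx (0 *: A) i j = (1%:M : 'M[R]_n) i j.
Proof.
rewrite expmxE; apply/cvg_lim => //; apply: cvg_near_cst; exists 1%N => // -[//|m] _.
rewrite /pseries /series /= big_nat_recl//= big1 ?addr0.
  by rewrite /expmx_coef expr0 fact0 divr1 mulr1.
by move=> k _; rewrite expr0n mulr0.
Qed.

End MatrixExponential.

(** * The continuized chain: Poisson averages and decay of the chi-square distance *)

Section ContinuousTime.
Local Open Scope classical_set_scope.
Variables (R : realType) (n : nat) (P : 'M[R]_n) (pi : 'rV[R]_n).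
Hypotheses (pi_distr : Defs.distribution pi) (pi_gt0 : forall x, 0 < pi 0 x).
Hypotheses (sP : stochastic P) (piP : pi *m P = pi).
Implicit Types (x y z i j : 'I_n) (t : R).

Let pi_sum : \sum_x pi 0 x = 1. Proof. by case: pi_distr. Qed.

(** With the density [phi = mu / pi], the derivative is twice the sum of [phi] against [mu P - mu],
    which [dform_expand] recognizes. Here [mu] is any solution of the forward equation, possibly
    signed, so that differences of two solutions are covered. *)
Lemma is_derive_chi2 (mu : R -> 'I_n -> R) t :
  (forall y, is_derive t 1 (mu^~ y) (\sum_z mu t z * P z y - mu t y)) ->
  is_derive t 1 (fun s => \sum_y mu s y ^+ 2 / pi 0 y)
    (- dform pi P (fun y => mu t y / pi 0 y)).
Proof.
move=> dmu.
rewrite (_ : (fun s => _) = fun s => \sum_y mu s y * mu s y * (pi 0 y)^-1); last first.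
  by apply/funext => s; apply: eq_bigr => y _; rewrite expr2.
have d (y : 'I_n) : is_derive t 1 (fun s => mu s y * mu s y * (pi 0 y)^-1)
    (2 * (mu t y / pi 0 y) * (\sum_z mu t z * P z y - mu t y)).
  have := is_derive_mulfr (pi 0 y)^-1 (is_derive_mulf (dmu y) (dmu y)).
  by congr (is_derive _ _ _ _); ring.
have := is_derive_bigsum d; congr (is_derive _ _ _ _).
rewrite (dform_expand _ sP piP) opprB -mulrBr exchange_big /=.
rewrite -sumrB mulr_sumr; apply: eq_bigr => y _.
have -> : \sum_x pi 0 x * P x y * (mu t x / pi 0 x * (mu t y / pi 0 y)) =
    (\sum_x mu t x * P x y) * (mu t y / pi 0 y).
  rewrite mulr_suml; apply: eq_bigr => x _; field.
  by rewrite !gt_eqF.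
by field; rewrite gt_eqF.
Qed.

Lemma is_derive_cont_kernel i j t :
  is_derive t 1 (fun s => cont_kernel P s i j)
    (\sum_z cont_kernel P t i z * P z j - cont_kernel P t i j).
Proof.
have := is_derive_expmx (P - 1%:M) i j t; congr (is_derive _ _ _ _).
rewrite (eq_bigr (fun l => cont_kernel P t i l * P l j -
    cont_kernel P t i l * (l == j)%:R)); last first.
  by move=> l _; rewrite !mxE mulrBr.
rewrite sumrB; congr (_ - _); rewrite (bigD1 j)//= eqxx mulr1 big1 ?addr0//.
by move=> l /negPf ->; rewrite mulr0.
Qed.

(* Both sides solve the Kolmogorov forward equation [mu' = mu (P - 1)] with the
   same initial value, and by [is_derive_chi2] the squared norm of their
   difference is nonincreasing. *)
Lemma cont_kernelE t i j : 0 <= t ->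
  cont_kernel P t i j = expR (- t) * expmx (t *: P) i j.
Proof.
move=> t0.
pose D s y := cont_kernel P s i y - expR (- 1 * s) * expmx (s *: P) i y.
have dD (s : R) y : is_derive s 1 (D^~ y) (\sum_z D s z * P z y - D s y).
  have := is_deriveB (is_derive_cont_kernel i y s)
    (is_derive_mulf (is_derive_expR_scale (- 1) s) (is_derive_expmx P i y s)).
  congr (is_derive _ _ _ _).
  rewrite /D [in RHS](eq_bigr (fun z => cont_kernel P s i z * P z y -
    expR (-1 * s) * (expmx (s *: P) i z * P z y))); last first.
    by move=> z _; ring.
  by rewrite sumrB -mulr_sumr; ring.
have D_t : \sum_y D t y ^+ 2 / pi 0 y <= 0.
  apply: (@le_trans _ _ (\sum_y D 0 y ^+ 2 / pi 0 y)).
    apply: (derive_le0_nonincreasing (fun s => is_derive_chi2 (dD s))) => // s _.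
    rewrite oppr_le0; apply: dform_ge0 => //; by case: sP.
  rewrite big1// => y _; rewrite /D mulr0 expR0 mul1r /cont_kernel !expmx0.
  by rewrite subrr expr0n mul0r.
have /eqP : D t j = 0.
  apply/eqP; rewrite -sqrf_eq0 eq_le sqr_ge0 andbT.
  rewrite -(ler_pM2r (x := (pi 0 j)^-1)) ?invr_gt0// mul0r.
  apply: le_trans D_t; rewrite (bigD1 j)//= lerDl sumr_ge0// => y _.
  by rewrite mulr_ge0 ?sqr_ge0// invr_ge0 ltW.
by rewrite subr_eq0 mulN1r => /eqP.
Qed.

(** A linear functional of the kernel at time [t] is the Poisson average of its values on the powers
    of [P]. The weights [w] cover entries, row sums, stationarity and Dirichlet forms at once. *)
Lemma cvg_cont_kernel t (w : 'I_n -> 'I_n -> R) : 0 <= t ->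
  (fun m => \sum_(0 <= k < m) (\sum_x \sum_y w x y * (P ^+ k) x y) *
     (t ^+ k / k`!%:R)) @ \oo -->
  expR t * \sum_x \sum_y w x y * cont_kernel P t x y.
Proof.
move=> t0.
have -> : expR t * \sum_x \sum_y w x y * cont_kernel P t x y =
    \sum_x \sum_y w x y * expmx (t *: P) x y.
  rewrite mulr_sumr; apply: eq_bigr => x _.
  rewrite mulr_sumr; apply: eq_bigr => y _.
  by rewrite cont_kernelE// mulrCA [expR t * _]mulrA -expRD subrr expR0 mul1r.
rewrite (_ : (fun m => _) = fun m => \sum_x \sum_y w x y *
    pseries (expmx_coef P x y) t m); last first.
  apply/funext => m.
  transitivity (\sum_x \sum_(0 <= k < m) \sum_y w x y * (P ^+ k) x y * (t ^+ k / k`!%:R)).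
    rewrite exchange_big /=; apply: eq_bigr => k _; rewrite mulr_suml.
    by apply: eq_bigr => x _; rewrite mulr_suml.
  apply: eq_bigr => x _; rewrite exchange_big /=; apply: eq_bigr => y _.
  rewrite /pseries /series /= mulr_sumr; apply: eq_bigr => k _.
  by rewrite /expmx_coef -!mulrA [t ^+ k * _]mulrC.
apply: cvg_big => [|x _]; first exact: add_continuous.
apply: cvg_big => [|y _]; first exact: add_continuous.
by apply: cvgMr; exact: cvg_expmx.
Qed.

Lemma cvg_exp_partial t :
  (fun m => \sum_(0 <= k < m) t ^+ k / k`!%:R) @ \oo --> expR t.
Proof. exact: is_cvg_series_exp_coeff. Qed.

Lemma exp_partial_le t m : 0 <= t -> \sum_(0 <= k < m) t ^+ k / k`!%:R <= expR t.
Proof.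
move=> t0; apply: (nondecreasing_cvgn_le _ (cvgP _ (@cvg_exp_partial t))).
by apply: nondecreasing_series => k _; rewrite mulr_ge0 ?invr_ge0 ?exprn_ge0.
Qed.

Lemma cont_kernel_le t (w : 'I_n -> 'I_n -> R) (b : nat -> R) (B : R) : 0 <= t ->
  (forall k, \sum_x \sum_y w x y * (P ^+ k) x y <= b k) ->
  (forall m, \sum_(0 <= k < m) b k * (t ^+ k / k`!%:R) <= expR t * B) ->
  \sum_x \sum_y w x y * cont_kernel P t x y <= B.
Proof.
move=> t0 wb bB; rewrite -(ler_pM2l (expR_gt0 t)).
rewrite -(cvg_lim _ (@cvg_cont_kernel t w t0))//.
apply: limr_le; first exact: cvgP (@cvg_cont_kernel t w t0).
apply: nearW => m; apply: le_trans (bB m); apply: ler_sum => k _.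
by apply: ler_wpM2r => //; rewrite mulr_ge0 ?invr_ge0 ?exprn_ge0.
Qed.

(** The sign of [c] matters: truncated Poisson weights have total mass at most one. *)
Lemma cont_kernel_cst_le t (w : 'I_n -> 'I_n -> R) c : 0 <= t -> 0 <= c ->
  (forall k, \sum_x \sum_y w x y * (P ^+ k) x y <= c) ->
  \sum_x \sum_y w x y * cont_kernel P t x y <= c.
Proof.
move=> t0 c0 wc; apply: (cont_kernel_le t0 wc) => m.
by rewrite -mulr_sumr mulrC; apply: ler_wpM2r => //; exact: exp_partial_le.
Qed.

Lemma cont_kernel_cst t (w : 'I_n -> 'I_n -> R) c : 0 <= t ->
  (forall k, \sum_x \sum_y w x y * (P ^+ k) x y = c) ->
  \sum_x \sum_y w x y * cont_kernel P t x y = c.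
Proof.
move=> t0 wc; apply: (mulfI (lt0r_neq0 (expR_gt0 t))).
rewrite -(cvg_lim _ (@cvg_cont_kernel t w t0))//; apply/cvg_lim => //.
rewrite (_ : (fun m => _) = fun m => (\sum_(0 <= k < m) t ^+ k / k`!%:R) * c).
  by apply: cvgMl; exact: cvg_exp_partial.
by apply/funext => m; rewrite mulr_suml; apply: eq_bigr => k _; rewrite wc mulrC.
Qed.

Lemma sum_delta (F : 'I_n -> R) x : \sum_y (y == x)%:R * F y = F x.
Proof.
rewrite (bigD1 x)//= eqxx mul1r big1 ?addr0// => y /negPf ->.
by rewrite mul0r.
Qed.

Lemma sum_delta2 (F : 'I_n -> 'I_n -> R) x y :
  \sum_z \sum_w ((z == x)%:R * (w == y)%:R) * F z w = F x y.
Proof.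
rewrite -[RHS](sum_delta (F x) y) -[RHS](sum_delta (fun z => \sum_w _ * F z w) x).
apply: eq_bigr => z _; rewrite mulr_sumr; apply: eq_bigr => w _.
by rewrite mulrA.
Qed.

Lemma cont_kernel_stochastic t : 0 <= t -> stochastic (cont_kernel P t).
Proof.
move=> t0; split=> [x y|x].
  (* Nonnegativity of an entry is obtained as the upper bound 0 on its opposite. *)
  rewrite -oppr_le0 -(sum_delta2 (fun x y => - cont_kernel P t x y)).
  under eq_bigr do under eq_bigr do rewrite mulrN -mulNr.
  apply: cont_kernel_cst_le => // k.
  under eq_bigr do under eq_bigr do rewrite mulNr -mulrN.
  rewrite (sum_delta2 (fun x y => - (P ^+ k) x y)) oppr_le0.
  by case: (stochasticX k sP).
rewrite -(sum_delta (fun x => \sum_y cont_kernel P t x y)).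
under eq_bigr do rewrite mulr_sumr.
apply: cont_kernel_cst => // k; under eq_bigr do rewrite -mulr_sumr.
by rewrite sum_delta; case: (stochasticX k sP).
Qed.

Lemma cont_kernel_stationary t : 0 <= t -> pi *m cont_kernel P t = pi.
Proof.
move=> t0; apply/stationaryP => y.
have E (K : 'M[R]_n) : \sum_x \sum_z pi 0 x * (z == y)%:R * K x z = \sum_x pi 0 x * K x y.
  apply: eq_bigr => x _; rewrite -(sum_delta (K x)) mulr_sumr.
  by apply: eq_bigr => z _; rewrite mulrA.
rewrite -E; apply: cont_kernel_cst => // k; rewrite E.
by move: y {E}; apply/stationaryP; exact: stationaryX.
Qed.

(** Truncated second moment of a Poisson law, from [k^2 = k (k - 1) + k]. *)
Lemma sum_sqr_exp_coef t m : \sum_(0 <= k < m.+2) k%:R ^+ 2 * (t ^+ k / k`!%:R) =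
  t ^+ 2 * (\sum_(0 <= k < m) t ^+ k / k`!%:R) +
  t * \sum_(0 <= k < m.+1) t ^+ k / k`!%:R.
Proof.
elim: m => [|m IHm].
  rewrite !big_nat_recr//= !big_geq// !fact0 factS fact0.
  by rewrite expr0n !expr1 expr0 !divr1 expr1n /= mulr0 !mul1r !mul0r !add0r mulr1.
rewrite big_nat_recr//= IHm [in RHS](big_nat_recr m)//= [in RHS](big_nat_recr m.+1)//=.
have -> : m.+2%:R ^+ 2 * (t ^+ m.+2 / (m.+2)`!%:R) =
    t ^+ 2 * (t ^+ m / m`!%:R) + t * (t ^+ m.+1 / (m.+1)`!%:R).
  have f0 : m`!%:R != 0 :> R by rewrite pnatr_eq0 -lt0n fact_gt0.
  rewrite !factS !natrM !exprS -[m.+2%:R]natr1 -![m.+1%:R]natr1.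
  field; rewrite f0 !natr1 !pnatr_eq0 //.
ring.
Qed.

(* The increments of the continuized chain over time [t] are those of a
   Poisson([t]) number of steps, whose second moment is [t ^+ 2 + t]. *)
Lemma dform_cont_kernel t phi : 0 <= t ->
  dform pi (cont_kernel P t) phi <= (t ^+ 2 + t) * dform pi P phi.
Proof.
move=> t0; set E := dform pi P phi.
have E0 : 0 <= E by apply: dform_ge0 => //; case: sP.
have dformE (K : 'M[R]_n) : dform pi K phi =
    \sum_x \sum_y pi 0 x * (phi x - phi y) ^+ 2 * K x y.
  by apply: eq_bigr => x _; apply: eq_bigr => y _; rewrite mulrAC.
rewrite dformE; apply: (cont_kernel_le (b := fun k => k%:R ^+ 2 * E) t0) => [k|m].
  by rewrite -dformE; exact: dformX.
under eq_bigr do rewrite mulrAC.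
rewrite -mulr_suml mulrA; apply: ler_wpM2r => //.
apply: (@le_trans _ _ (\sum_(0 <= k < m.+2) k%:R ^+ 2 * (t ^+ k / k`!%:R))).
  rewrite 2?big_nat_recr//= -addrA lerDl.
  by rewrite addr_ge0// !mulr_ge0 ?sqr_ge0 ?exprn_ge0 ?invr_ge0.
rewrite sum_sqr_exp_coef mulrDr; apply: lerD; rewrite [leRHS]mulrC.
  by apply: ler_wpM2l; rewrite ?sqr_ge0//; exact: exp_partial_le.
by apply: ler_wpM2l => //; exact: exp_partial_le.
Qed.

(** The chain has not jumped before time [t] with probability [expR (- t)], which is the term of
    index 0 of the series. *)
Lemma cont_kernel_diag t y : 0 <= t -> 1 - t <= cont_kernel P t y y.
Proof.
move=> t0; apply: (@le_trans _ _ (expR (- t))); first exact: expR_ge1Dx.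
rewrite cont_kernelE// -{1}[expR _]mulr1; apply: ler_wpM2l; first exact: expR_ge0.
rewrite -(cvg_lim _ (@cvg_expmx _ _ P t y y))//.
apply: limr_ge; first exact: cvgP (@cvg_expmx _ _ P t y y).
exists 1%N => // -[//|m] _ /=.
rewrite /pseries /series /= big_nat_recl//= {1}/expmx_coef expr0 fact0 divr1 mulr1.
rewrite mxE eqxx lerDl sumr_ge0// => k _.
by rewrite !mulr_ge0 ?invr_ge0 ?exprn_ge0//; case: (stochasticX k.+1 sP).
Qed.

(** Cauchy-Schwarz under [pi], in the form of nonnegativity of the variance of [|mu - pi| / pi]. *)
Lemma tvdist_chi2 (mu : 'rV[R]_n) : \sum_y mu 0 y = 1 ->
  tvdist mu pi ^+ 2 <= 4^-1 * (\sum_y mu 0 y ^+ 2 / pi 0 y - 1).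
Proof.
move=> mu1; rewrite /tvdist exprMn (_ : 2^-1 ^+ 2 = 4^-1); last by field.
apply: ler_wpM2l; first by rewrite invr_ge0.
have -> : \sum_y mu 0 y ^+ 2 / pi 0 y - 1 =
    \sum_y pi 0 y * (`|mu 0 y - pi 0 y| / pi 0 y) ^+ 2.
  rewrite [RHS](eq_bigr (fun y => mu 0 y ^+ 2 / pi 0 y - 2 * mu 0 y + pi 0 y)).
    by rewrite big_split sumrB -mulr_sumr mu1 pi_sum /=; ring.
  move=> y _; rewrite exprMn real_normK ?num_real//; field.
  by rewrite gt_eqF.
have -> : \sum_y `|mu 0 y - pi 0 y| = \sum_y pi 0 y * (`|mu 0 y - pi 0 y| / pi 0 y).
  by apply: eq_bigr => y _; rewrite mulrC divfK// gt_eqF.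
have := dvar_expand pi_distr (fun y => `|mu 0 y - pi 0 y| / pi 0 y).
have := @dform_ge0 _ _ _ pi_distr (equilibrium pi)
  (fun y => `|mu 0 y - pi 0 y| / pi 0 y) (equilibrium_stochastic pi_distr).1.
lra.
Qed.

(** Gronwall's argument: the density [u] has mean 1, so [2 h] is the form of [equilibrium] at [u],
    while [h' = - dform pi P u]; hence [expR (2 / C * s) * h s] is nonincreasing. *)
Lemma chi2_decay (C t : R) x : 0 < C ->
  (forall phi, dform pi (equilibrium pi) phi <= C * dform pi P phi) -> 0 <= t ->
  \sum_y cont_kernel P t x y ^+ 2 / pi 0 y - 1 <=
    expR (- (2 / C * t)) * ((pi 0 x)^-1 - 1).
Proof.
move=> C0 poincare t0.
pose h s := \sum_y cont_kernel P s x y ^+ 2 / pi 0 y - 1.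
pose u s y := cont_kernel P s x y / pi 0 y.
have dh (s : R) : is_derive s 1 h (- dform pi P (u s)).
  rewrite -[X in is_derive _ _ _ X]subr0.
  apply: is_deriveB; first exact: (is_derive_chi2 (fun y => is_derive_cont_kernel x y s)).
have hE s : 0 <= s -> 2 * h s = dform pi (equilibrium pi) (u s).
  move=> s0; rewrite dvar_expand// /h /u.
  rewrite [X in _ = _ - 2 * X ^+ 2](eq_bigr (cont_kernel P s x)); last first.
    by move=> y _; rewrite mulrC divfK// gt_eqF.
  case: (cont_kernel_stochastic s0) => _ ->.
  rewrite mulrBr; congr (2 * _ - _); last by rewrite expr1n.
  by apply: eq_bigr => y _; field; rewrite gt_eqF.
have h0 : h 0 = (pi 0 x)^-1 - 1.
  rewrite /h (bigD1 x)//= /cont_kernel expmx0 mxE eqxx expr1n mul1r big1 ?addr0//.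
  move=> y /negPf yx; rewrite expmx0 mxE eq_sym yx expr0n mul0r//.
have := derive_le0_nonincreasing
  (fun s => is_derive_mulf (is_derive_expR_scale (2 / C) s) (dh s)) _ t0.
rewrite mulr0 expR0 mul1r h0 -/(h t) => le_h.
rewrite -(ler_pM2l (expR_gt0 (2 / C * t))) mulrA -expRD subrr expR0 mul1r.
apply: le_h => s s0.
have -> : expR (2 / C * s) * - dform pi P (u s) + h s * (2 / C * expR (2 / C * s)) =
    expR (2 / C * s) * (C^-1 * (2 * h s - C * dform pi P (u s))).
  by field; rewrite gt_eqF.
rewrite mulr_ge0_le0 ?expR_ge0// mulr_ge0_le0 ?invr_ge0 ?(ltW C0)//.
by rewrite subr_le0 hE.
Qed.

Lemma cont_kernel_mixing (C t eps : R) x : 0 < C ->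
  (forall phi, dform pi (equilibrium pi) phi <= C * dform pi P phi) ->
  0 < eps -> 0 <= t -> C / 2 * ln ((eps ^+ 2 * pi 0 x)^-1) <= t ->
  tvdist (row x (cont_kernel P t)) pi <= eps.
Proof.
move=> C0 poincare eps0 t0 Lt.
have e2 : 0 < eps ^+ 2 by exact: exprn_gt0.
rewrite -(ler_pXn2r (n := 2))// ?nnegrE ?(ltW eps0)//; last first.
  by rewrite mulr_ge0 ?invr_ge0 ?sumr_ge0.
apply: le_trans (tvdist_chi2 _) _.
  by under eq_bigr do rewrite mxE; case: (cont_kernel_stochastic t0).
under eq_bigr do rewrite mxE.
have := chi2_decay x C0 poincare t0.
set h := \sum_y _ - 1 => hle.
suff : h <= eps ^+ 2 by have := e2; lra.
apply: (le_trans hle).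
apply: (@le_trans _ _ (expR (- (2 / C * t)) * (pi 0 x)^-1)).
  by apply: ler_wpM2l; [exact: expR_ge0|rewrite gerBl].
rewrite ler_pdivrMr//.
rewrite -[leRHS]invrK -[X in _ <= X^-1]lnK ?posrE ?invr_gt0 ?mulr_gt0//.
rewrite -expRN ler_expR lerN2.
rewrite -(ler_pM2l (x := C / 2)) ?divr_gt0//.
apply: (le_trans Lt).
rewrite le_eqVlt; apply/orP; left; apply/eqP; field.
by rewrite gt_eqF.
Qed.

Lemma cmix_time_x_le (C eps : R) x : 0 <= C ->
  (forall phi, dform pi (equilibrium pi) phi <= C * dform pi P phi) ->
  0 < eps -> eps ^+ 2 * pi 0 x <= 1 ->
  cmix_time_x P pi eps x <= C / 2 * ln ((eps ^+ 2 * pi 0 x)^-1).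
Proof.
move=> C0 poincare eps0 eps1.
set L := ln _.
have L0 : 0 <= L.
  by apply: ln_ge0; rewrite invf_ge1// mulr_gt0// exprn_gt0.
apply/ler_addgt0Pr => e e0.
(* The constant [C] may vanish, whereas the decay needs a positive one and the infimum ranges over
   positive times. The slack [e] pays for both: the enlarged constant costs at most
   [e * L / (2 * (L + 1))]. *)
pose C' := C + e / (L + 1).
have L1 : 0 < L + 1 by rewrite ltr_wpDl.
have eL : 0 < e / (L + 1) by rewrite divr_gt0.
have C'0 : 0 < C' by rewrite ltr_wpDl.
have C'L : C' / 2 * L <= C / 2 * L + e.
  rewrite /C' mulrDl mulrDl lerD2l.
  have -> : e / (L + 1) / 2 * L = e * L / 2 / (L + 1) by ring.
  rewrite ler_pdivrMr// mulrDr mulr1.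
  have : 0 <= e * L by rewrite mulr_ge0// ltW.
  by move: e0; lra.
have T0 : 0 < C / 2 * L + e by rewrite ltr_wpDl// !mulr_ge0.
apply: ge_inf; first by exists 0 => t [/ltW].
split=> // t tT.
apply: (cont_kernel_mixing C'0) => //.
- move=> phi; apply: (le_trans (poincare phi)); apply: ler_wpM2r.
    by apply: dform_ge0 => //; case: sP.
  by rewrite lerDl ltW.
- exact: le_trans (ltW T0) tT.
- exact: le_trans C'L tT.
Qed.

End ContinuousTime.

(** * Return times and convergence of ergodic chains *)

Lemma numerical_semigroup (S : nat -> Prop) : S 0%N ->
  (forall s t, S s -> S t -> S (s + t)%N) ->
  (forall d : nat, (forall t, (0 < t)%N -> S t -> (d %| t)%N) -> d = 1%N) ->
  exists N, forall t, (N <= t)%N -> S t.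
Proof.
move=> S0 SD Sgcd.
have SM q s : S s -> S (q * s)%N.
  by move=> Ss; elim: q => // q IHq; rewrite mulSn; exact: SD.
(* The least positive difference [d] of two elements divides every element [u], since otherwise
   [u %% d] would be a smaller difference. Hence [d = 1], and [S] contains consecutive numbers. *)
pose gap d := [&& (0 < d)%N & `[< exists2 s, S s & S (s + d)%N >]].
have exgap : exists d, gap d.
  apply: contrapT => nogap; have : 2%N = 1%N; last by [].
  apply: Sgcd => t t0 St; exfalso; apply: nogap; exists t.
  by rewrite /gap t0; apply/asboolP; exists 0%N.
case: (ex_minnP exgap) => d /andP[d0 /asboolP[s Ss Ssd]] dmin.
have d1 : d = 1%N.
  apply: Sgcd => u _ Su; rewrite /dvdn; apply: contraT; rewrite -lt0n => r0.
  suff /dmin : gap (u %% d)%N by rewrite leqNgt ltn_mod d0.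
  rewrite /gap r0; apply/asboolP; exists (u %/ d * (s + d))%N; first exact: SM.
  have -> : (u %/ d * (s + d) + u %% d = u + u %/ d * s)%N.
    by have := divn_eq u d; rewrite mulnDr; lia.
  by apply: SD => //; exact: SM.
move: Ssd; rewrite d1 => Ss1.
have [s0|s0] := posnP s.
  by exists 0%N => t _; move: Ss1; rewrite s0 => /(SM t); rewrite muln1.
(* Beyond [s * s] the quotient of [t] by [s] exceeds the remainder, so [t] is a sum of copies of [s]
   and [s + 1]. *)
exists (s * s)%N => t st.
have -> : (t = (t %/ s - t %% s) * s + t %% s * (s + 1))%N.
  have : (t %% s < s)%N by rewrite ltn_mod.
  have : (s <= t %/ s)%N by rewrite leq_divRL.
  have := divn_eq t s; nia.
by apply: SD; exact: SM.
Qed.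

Section Convergence.
Local Open Scope classical_set_scope.
Variables (R : realType) (n : nat) (P : 'M[R]_n) (pi : 'rV[R]_n).
Hypotheses (sP : stochastic P) (irrP : irreducible P) (aperP : aperiodic P).
Hypotheses (pi_distr : Defs.distribution pi) (piP : pi *m P = pi).
Implicit Types (x y z : 'I_n).

Lemma mulmx_entry_gt0 (K L : 'M[R]_n) x y z :
  (forall x y, 0 <= K x y) -> (forall x y, 0 <= L x y) ->
  0 < K x y -> 0 < L y z -> 0 < (K *m L) x z.
Proof.
move=> K0 L0 Kxy Lyz; rewrite mxE (bigD1 y)//=.
by rewrite ltr_wpDr ?mulr_gt0// sumr_ge0// => w _; rewrite mulr_ge0.
Qed.

Lemma exprmxD s t : P ^+ (s + t) = P ^+ s *m P ^+ t.
Proof. exact: exprD. Qed.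

Lemma pow_entry_gt0 s t x y z :
  0 < (P ^+ s) x y -> 0 < (P ^+ t) y z -> 0 < (P ^+ (s + t)) x z.
Proof.
rewrite exprmxD; apply: mulmx_entry_gt0 => u v.
  by case: (stochasticX s sP).
by case: (stochasticX t sP).
Qed.

Lemma stationary_gt0 y : 0 < pi 0 y.
Proof.
case: pi_distr => pi0 pi1.
have [x pix] : exists x, 0 < pi 0 x.
  apply: contrapT => npi; move: pi1; rewrite big1.
    by move/eqP; rewrite eq_sym oner_eq0.
  move=> x _; apply/eqP; rewrite eq_le pi0 andbT leNgt.
  by apply/negP => pix; apply: npi; exists x.
have [t Pt] := irrP x y.
have /stationaryP <- := stationaryX t piP.
rewrite (bigD1 x)//= ltr_wpDr ?mulr_gt0// sumr_ge0// => z _.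
by rewrite mulr_ge0//; case: (stochasticX t sP).
Qed.

Lemma ergodic_pow_gt0 : exists N, forall x y, 0 < (P ^+ N) x y.
Proof.
have [k Pk] := boolp.choice (fun xy : 'I_n * 'I_n => irrP xy.1 xy.2).
have [x|l Pl] := boolp.choice (P := fun x l => forall t, (l <= t)%N -> 0 < (P ^+ t) x x).
  apply: (@numerical_semigroup (fun t => 0 < (P ^+ t) x x)).
  - by rewrite expr0 mxE eqxx.
  - by move=> s t; exact: pow_entry_gt0.
  - by move=> d dP; exact: (aperP dP).
(* The sum merely dominates every [l x + k (x, y)]: the chain returns to [x] for the remaining time,
   then goes to [y]. *)
pose N := (\sum_x \sum_y (l x + k (x, y)))%N.
exists N => x y.
have lkN : (l x + k (x, y) <= N)%N.
  rewrite /N (bigD1 x)//= (bigD1 y)//=; lia.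
rewrite -(subnK (leq_trans (leq_addl _ _) lkN)).
by apply: pow_entry_gt0 (Pk (x, y)); apply: Pl; lia.
Qed.

(** Subtracting [d * pi 0 y] from [K x y] does not change the action on [mu], whose total mass is 0,
    and leaves a nonnegative kernel with row sums [1 - d]. The case [d = 0] gives monotonicity in
    time. *)
Lemma doeblin (K : 'M[R]_n) (mu : 'rV[R]_n) (d : R) : stochastic K -> 0 <= d ->
  (forall x y, d * pi 0 y <= K x y) -> \sum_x mu 0 x = 0 ->
  \sum_y `|(mu *m K) 0 y| <= (1 - d) * \sum_x `|mu 0 x|.
Proof.
move=> [_ K1] d0 dK mu0.
apply: (@le_trans _ _ (\sum_y \sum_x `|mu 0 x| * (K x y - d * pi 0 y))).
  apply: ler_sum => y _.
  have -> : (mu *m K) 0 y = \sum_x mu 0 x * (K x y - d * pi 0 y).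
    rewrite mxE; under [RHS]eq_bigr do rewrite mulrBr.
    by rewrite sumrB -mulr_suml mu0 mul0r subr0.
  apply: (le_trans (ler_norm_sum _ _ _)); apply: ler_sum => x _.
  by rewrite normrM (ger0_norm (_ : 0 <= K x y - _)) ?subr_ge0.
rewrite exchange_big mulr_sumr; apply: ler_sum => x _ /=.
rewrite -mulr_sumr sumrB K1 -mulr_sumr.
by case: pi_distr => _ ->; rewrite mulr1 mulrC.
Qed.

Lemma row_pow_sub x s t :
  row x (P ^+ (s + t)) - pi = (row x (P ^+ s) - pi) *m P ^+ t.
Proof. by rewrite mulmxBl (stationaryX t piP) exprmxD row_mul. Qed.

Lemma row_pow_sub_sum x s : \sum_y (row x (P ^+ s) - pi) 0 y = 0.
Proof.
under eq_bigr do rewrite !mxE.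
rewrite sumrB; case: (stochasticX s sP) => _ ->.
by case: pi_distr => _ ->; rewrite subrr.
Qed.

Lemma tvdistE (u v : 'rV[R]_n) : tvdist u v = 2^-1 * \sum_y `|(u - v) 0 y|.
Proof. by congr (_ * _); apply: eq_bigr => y _; rewrite !mxE. Qed.

Lemma tvdist_pow_nonincreasing x s t :
  tvdist (row x (P ^+ (s + t))) pi <= tvdist (row x (P ^+ s)) pi.
Proof.
rewrite !tvdistE ler_pM2l ?invr_gt0// row_pow_sub.
rewrite -[leRHS]mul1r -[X in X * _]subr0; apply: doeblin => //.
- exact: stochasticX.
- by move=> y z; rewrite mul0r; case: (stochasticX t sP).
- exact: row_pow_sub_sum.
Qed.

Lemma ergodic_cvg eps : 0 < eps -> exists N, (0 < N)%N /\
  forall t x, (N <= t)%N -> tvdist (row x (P ^+ t)) pi <= eps.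
Proof.
move=> eps0; have [N PN] := ergodic_pow_gt0.
case: pi_distr => pi0 pi1.
(* The smallest entry of [P ^+ N], capped at 1, is a Doeblin constant because [pi 0 y <= 1]. *)
pose d : R := \big[Num.min/1]_x \big[Num.min/1]_y (P ^+ N) x y.
have d0 : 0 < d by apply: lt_bigmin => // x _; apply: lt_bigmin.
have d1 : d <= 1 by exact: bigmin_le_id.
have dP x y : d * pi 0 y <= (P ^+ N) x y.
  apply: (@le_trans _ _ d).
    rewrite -[leRHS]mulr1 ler_pM2l// -pi1 (bigD1 y)//= lerDl.
    by apply: sumr_ge0.
  apply: (@le_trans _ _ (\big[Num.min/1]_z (P ^+ N) x z)).
    exact: (bigmin_le_cond _ (fun x => \big[Num.min/1]_y (P ^+ N) x y)).
  exact: (bigmin_le_cond _ (fun y => (P ^+ N) x y)).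
have contr k x : tvdist (row x (P ^+ (k * N))) pi <= (1 - d) ^+ k.
  rewrite tvdistE; elim: k => [|k IHk].
    rewrite mul0n expr0 expr0.
    apply: (@le_trans _ _ (2^-1 * \sum_y ((1%:M : 'M[R]_n) x y + pi 0 y))).
      apply: ler_wpM2l; first by rewrite invr_ge0.
      apply: ler_sum => y _; rewrite !mxE.
      by apply: (le_trans (ler_normB _ _)); rewrite !ger0_norm.
    rewrite big_split /= pi1; have [_ /(_ x)] := stochasticX 0 sP.
    by rewrite expr0 => ->; lra.
  rewrite mulSn addnC row_pow_sub exprS.
  apply: le_trans (_ : (1 - d) * (2^-1 * _) <= _); last first.
    by apply: ler_wpM2l IHk; rewrite subr_ge0.
  rewrite mulrCA ler_pM2l ?invr_gt0//; apply: doeblin (ltW d0) dP _.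
    exact: stochasticX.
  exact: row_pow_sub_sum.
have : (fun k => (1 - d) ^+ k) @ \oo --> (0 : R).
  by apply: cvg_expr; rewrite ger0_norm ?subr_ge0// ltrBlDr ltrDl.
move=> /cvgr0_norm_le /(_ eps eps0) [k _ kP].
have kle : (1 - d) ^+ k <= eps.
  by apply: le_trans (ler_norm _) _; exact: (kP k (leqnn k)).
exists (k * N).+1; split=> // t x tk.
rewrite -(subnKC (ltnW tk)).
apply: le_trans (tvdist_pow_nonincreasing _ _ _) _.
exact: le_trans (contr k x) kle.
Qed.

End Convergence.

(** * From mixing times to Poincare inequalities *)

Section Comparison.
Local Open Scope classical_set_scope.
Variable R : realType.

(** A mixing time is an infimum, so mixing is known only at times strictly beyond it; this lets [t]
    decrease to [tau]. *)
Lemma le_sqr_limit (A B tau : R) : 0 <= tau -> 0 <= B ->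
  (forall t, tau < t -> A <= t ^+ 2 * B) -> A <= tau ^+ 2 * B.
Proof.
move=> tau0 B0 AB; apply/ler_addgt0Pr => e e0.
pose D := (2 * tau + 1) * B + e.
have TB : 0 <= (2 * tau + 1) * B by rewrite mulr_ge0// addr_ge0// mulr_ge0.
have D0 : 0 < D by rewrite ltr_wpDl.
pose d := e / D.
have d0 : 0 < d by rewrite divr_gt0.
have d1 : d <= 1 by rewrite ler_pdivrMr// mul1r lerDr.
have dB : d * ((2 * tau + 1) * B) <= e.
  rewrite /d mulrAC ler_pdivrMr//; apply: ler_wpM2l; first exact: ltW.
  by rewrite lerDl ltW.
apply: (le_trans (AB (tau + d) _)); first by rewrite ltrDl.
have -> : (tau + d) ^+ 2 * B = tau ^+ 2 * B + d * ((2 * tau + d) * B) by ring.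
rewrite lerD2l; apply: le_trans dB; apply: ler_wpM2l; first exact: ltW.
by apply: ler_wpM2r => //; rewrite lerD2l.
Qed.

Lemma expR1_inv_le : (expR 1)^-1 <= 4 / 9 :> R.
Proof.
have e94 : 9 / 4 <= expR 1 :> R.
  rewrite [X in expR X](_ : 1 = 2^-1 + 2^-1); last by lra.
  rewrite (_ : 9 / 4 = 3 / 2 * (3 / 2)); last by lra.
  by rewrite expRD; have := @expR_ge1Dx R 2^-1 => h; apply: ler_pM => //; lra.
by rewrite -div1r ler_pdivrMr ?expR_gt0//; lra.
Qed.

(** The excess at [y] is compensated by an equal deficit elsewhere, which cancels the factor 1/2. *)
Lemma tvdist_ge (n : nat) (u v : 'rV[R]_n) y :
  \sum_i u 0 i = \sum_i v 0 i -> u 0 y - v 0 y <= tvdist u v.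
Proof.
move=> /eqP; rewrite -subr_eq0 -sumrB (bigD1 y)//= addr_eq0 => /eqP uv.
rewrite /tvdist (bigD1 y)//=.
have := ler_norm_sum (index_enum 'I_n) (fun i => u 0 i - v 0 i) (fun i => i != y).
have := ler_norm (u 0 y - v 0 y).
rewrite -[in X in _ -> X <= _ -> _]normrN -uv; lra.
Qed.

Variables (n : nat) (P : 'M[R]_n) (pi : 'rV[R]_n).
Hypotheses (ergP : ergodic P) (statP : stationary P pi).

Let sP : stochastic P. Proof. by case: ergP. Qed.
Let pi_distr : Defs.distribution pi. Proof. by case: statP. Qed.
Let piP : pi *m P = pi. Proof. by case: statP. Qed.

Let pi_gt0 x : 0 < pi 0 x.
Proof. by apply: (stationary_gt0 sP) => //; case: ergP. Qed.

Let dformP_ge0 phi : 0 <= dform pi P phi.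
Proof. by apply: dform_ge0 => //; case: sP. Qed.

Lemma poincare_pow (N : nat) phi :
  (forall x, tvdist (row x (P ^+ N)) pi <= (2 * expR 1)^-1) ->
  (2^-1 - (expR 1)^-1) * dform pi (equilibrium pi) phi <=
    N%:R ^+ 2 * dform pi P phi.
Proof.
move=> mixN; apply: le_trans _ (dformX pi_distr phi N sP piP).
apply: dform_tv => //; [exact: stochasticX|exact: stationaryX|].
move=> x; have := mixN x; rewrite /tvdist invfM ler_pM2l ?invr_gt0//.
by under eq_bigr do rewrite mxE.
Qed.

Lemma mix_time_lt t : mix_time P pi (2 * expR 1)^-1 < t ->
  exists2 N : nat, N%:R <= t &
    forall x, tvdist (row x (P ^+ N)) pi <= (2 * expR 1)^-1.
Proof.
move=> tau_t.
have t0 : 0 <= t by apply: le_trans (ltW tau_t); exact: bigmax_ge_id.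
(* A mixing step count below [t] is at most the integer part of [t], and mixing persists by
   definition, so the integer part serves every [x] at once. *)
exists (Num.truncn t); first by rewrite truncn_le.
move=> x.
have : mix_time_x P pi (2 * expR 1)^-1 x < t.
  by apply: le_lt_trans tau_t; exact: le_bigmax.
case/inf_lt => [|_ [N [N0 NP] <-] Nt].
  have [_ irrP aperP] := ergP.
  have e0 : 0 < (2 * expR 1)^-1 :> R by rewrite invr_gt0 mulr_gt0 ?expR_gt0.
  have [N [N0 NP]] := ergodic_cvg sP irrP aperP pi_distr piP e0.
  by exists N%:R; exists N => //; split=> // t' /NP.
by apply: NP; rewrite -ltnS -(ltr_nat R); apply: lt_trans Nt _; exact: truncnS_gt.
Qed.

(** The 8 is twice the 4 of the theorem, since a Poincare constant [C] gives a mixing bound with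
    factor [C / 2]. Numerically, [1/e <= 4/9] suffices. *)
Lemma poincare_mix_time phi :
  (2^-1 - (2 * expR 1)^-1) ^+ 2 / 8 * dform pi (equilibrium pi) phi <=
  mix_time P pi (2 * expR 1)^-1 ^+ 2 * dform pi P phi.
Proof.
have V0 : 0 <= dform pi (equilibrium pi) phi.
  by apply: dform_ge0 => //; case: (equilibrium_stochastic pi_distr).
apply: (@le_trans _ _ ((2^-1 - (expR 1)^-1) * dform pi (equilibrium pi) phi)).
  apply: ler_wpM2r => //; rewrite invfM.
  have := expR1_inv_le; have : 0 < (expR 1)^-1 :> R by rewrite invr_gt0 expR_gt0.
  set a := _^-1; nra.
apply: le_sqr_limit => //; first exact: bigmax_ge_id.
move=> t /mix_time_lt[N Nt /poincare_pow NP].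
apply: (le_trans (NP _)); apply: ler_wpM2r => //.
have t0 : 0 <= t by apply: le_trans Nt.
by rewrite ler_pXn2r ?nnegrE.
Qed.

Lemma cmix_time_lt t : cmix_time P pi (2 * expR 1)^-1 < t ->
  0 < t /\ forall x, tvdist (row x (cont_kernel P t)) pi <= (2 * expR 1)^-1.
Proof.
move=> tau_t.
have t0 : 0 < t by apply: le_lt_trans tau_t; exact: bigmax_ge_id.
split=> // x.
have : cmix_time_x P pi (2 * expR 1)^-1 x < t.
  by apply: le_lt_trans tau_t; exact: le_bigmax.
case/inf_lt => [|s [_ sP'] st]; last exact: sP' (ltW st).
have e0 : 0 < (2 * expR 1)^-1 :> R by rewrite invr_gt0 mulr_gt0 ?expR_gt0.
have [_ irrP aperP] := ergP.
have [N [N0 NP]] := ergodic_cvg sP irrP aperP pi_distr piP e0.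
have c0 : 0 < 2^-1 - (expR 1)^-1 :> R by have := expR1_inv_le; lra.
(* Mixing of the discrete chain after [N] steps gives a Poincare constant, hence convergence of the
   continuized chain. *)
pose C : R := N%:R ^+ 2 / (2^-1 - (expR 1)^-1).
have C0 : 0 < C by rewrite divr_gt0// exprn_gt0// ltr0n.
have poincare phi : dform pi (equilibrium pi) phi <= C * dform pi P phi.
  rewrite /C mulrAC ler_pdivlMr// mulrC.
  by apply: poincare_pow => y; exact: NP.
pose L : R := `|C / 2 * ln (((2 * expR 1)^-1 ^+ 2 * pi 0 x)^-1)|.
exists (L + 1); split; first by rewrite ltr_wpDl// normr_ge0.
move=> s Ls; have Ls' : L <= s by apply: le_trans Ls; rewrite lerDl.
apply: (cont_kernel_mixing pi_distr pi_gt0 sP piP C0 poincare e0).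
  by apply: le_trans Ls'; exact: normr_ge0.
by apply: le_trans Ls'; exact: ler_norm.
Qed.

Lemma poincare_cmix_time phi :
  (2^-1 - (2 * expR 1)^-1) ^+ 2 / 8 * dform pi (equilibrium pi) phi <=
  cmix_time P pi (2 * expR 1)^-1 ^+ 2 * dform pi P phi.
Proof.
have V0 : 0 <= dform pi (equilibrium pi) phi.
  by apply: dform_ge0 => //; case: (equilibrium_stochastic pi_distr).
apply: le_sqr_limit => //; first exact: bigmax_ge_id.
move=> t /cmix_time_lt[t0 mix_t].
have [[y piy]|pi_gt_half] := pselect (exists y, pi 0 y <= 2^-1); last first.
  (* here the state space has at most one element *)
  have -> : dform pi (equilibrium pi) phi = 0.
    rewrite /dform big1// => x _; rewrite big1// => y _.
    have [->|yx] := eqVneq y x; first by rewrite subrr expr0n mulr0.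
    exfalso; case: pi_distr => pi0 pi1.
    have half z : 2^-1 < pi 0 z.
      by rewrite ltNge; apply/negP => zle; apply: pi_gt_half; exists z.
    move: pi1; rewrite (bigD1 x)//= (bigD1 y)//=.
    have : 0 <= \sum_(i < n | (i != x) && (i != y)) pi 0 i by exact: sumr_ge0.
    by have := half x; have := half y; lra.
  by rewrite mulr0 mulr_ge0// sqr_ge0.
have HP : (2^-1 - (expR 1)^-1) * dform pi (equilibrium pi) phi <=
    (t ^+ 2 + t) * dform pi P phi.
  apply: le_trans (dform_cont_kernel pi_distr pi_gt0 sP piP phi (ltW t0)).
  apply: dform_tv => //.
  - exact: (cont_kernel_stochastic pi_distr pi_gt0 sP piP (ltW t0)).
  - exact: (cont_kernel_stationary pi_distr pi_gt0 sP piP (ltW t0)).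
  move=> x; have := mix_t x; rewrite /tvdist invfM ler_pM2l ?invr_gt0//.
  by under eq_bigr do rewrite mxE.
(* A state of mass at most 1/2 is still occupied with probability at least
   [1 - t] at time [t], so mixing is not instantaneous and the linear term of
   [t ^+ 2 + t] is absorbed by the quadratic one. *)
have t_ge : 2^-1 - (2 * expR 1)^-1 <= t.
  have := cont_kernel_diag pi_distr pi_gt0 sP piP y (ltW t0).
  have := mix_t y.
  suff : cont_kernel P t y y - pi 0 y <= tvdist (row y (cont_kernel P t)) pi.
    by move: piy; lra.
  have -> : cont_kernel P t y y = row y (cont_kernel P t) 0 y by rewrite [RHS]mxE.
  apply: tvdist_ge; case: pi_distr => _ ->; under eq_bigr do rewrite mxE.
  by case: (cont_kernel_stochastic pi_distr pi_gt0 sP piP (ltW t0)).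
have tE : (t ^+ 2 + t) * (2^-1 - (2 * expR 1)^-1) <=
    t ^+ 2 * (1 + (2^-1 - (2 * expR 1)^-1)).
  by have := ler_wpM2l (ltW t0) t_ge; rewrite expr2; lra.
move: HP tE t_ge (dformP_ge0 phi); rewrite invfM.
have := expR1_inv_le; have : 0 < (expR 1)^-1 :> R by rewrite invr_gt0 expR_gt0.
set V := dform _ _ _ in V0 *; set E := dform _ _ _; set a := _^-1.
move=> a0 a1 VE tE ta E0.
have k0 : 0 < 2^-1 - 2^-1 * a by lra.
(* This inequality between constants remains once [t ^+ 2 + t] is bounded by [t ^+ 2 * (1 + k) / k],
   where [k] is [1/2 - 1/(2e)]. *)
have kb : (2^-1 - 2^-1 * a) / 8 * (1 + (2^-1 - 2^-1 * a)) <= 2^-1 - a by nra.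
move: k0 kb tE; set k := 2^-1 - 2^-1 * a => k0 kb tE.
have b0 : 0 < 1 + k by rewrite addr_gt0.
rewrite -(ler_pM2r b0).
have -> : k ^+ 2 / 8 * V * (1 + k) = k * (k / 8 * (1 + k) * V) by ring.
apply: (@le_trans _ _ (k * ((2^-1 - a) * V))).
  by rewrite ler_pM2l// ler_wpM2r.
apply: (@le_trans _ _ (k * ((t ^+ 2 + t) * E))); first by rewrite ler_pM2l.
rewrite mulrA [k * _]mulrC [leRHS]mulrAC.
by apply: ler_wpM2r.
Qed.

End Comparison.

(** * Assembly, common to both mixing times of [P'] *)

Lemma cmix_time_x_flow (R : realType) (n : nat) (P P' : 'M[R]_n) (pi : 'rV[R]_n)
  (f : seq 'I_n -> R) (eps tau k : R) (x : 'I_n) :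
  ergodic P -> ergodic P' -> stationary P pi -> is_flow P P' pi f ->
  0 < eps -> eps ^+ 2 * pi 0 x <= 1 -> 0 < k ->
  (forall phi, k ^+ 2 / 8 * dform pi (equilibrium pi) phi <=
     tau ^+ 2 * dform pi P' phi) ->
  cmix_time_x P pi eps x <= 4 * congestion P P' pi f * (tau ^+ 2 / k ^+ 2) *
    ln ((eps ^+ 2 * pi 0 x)^-1).
Proof.
move=> ergP ergP' [pi_distr piP] flow eps0 eps1 k0 poincare'.
have [sP irrP _] := ergP; have [sP' _ _] := ergP'.
have pi_gt0 := stationary_gt0 sP irrP pi_distr piP.
(* The Poincare constant of [P'], [8 * tau ^+ 2 / k ^+ 2], times the congestion that transfers it to
   [P]. *)
pose C := 8 * congestion P P' pi f * (tau ^+ 2 / k ^+ 2).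
have -> : 4 * congestion P P' pi f * (tau ^+ 2 / k ^+ 2) = C / 2.
  by rewrite /C; field; rewrite gt_eqF.
have A0 := congestion_ge0 P P' pi f.
apply: cmix_time_x_le => //.
  by rewrite /C mulr_ge0 ?divr_ge0 ?sqr_ge0// mulr_ge0.
move=> phi.
have k8 : 0 < k ^+ 2 / 8 by rewrite divr_gt0// exprn_gt0.
rewrite -(ler_pM2l k8); apply: (le_trans (poincare' phi)).
have -> : k ^+ 2 / 8 * (C * dform pi P phi) =
    tau ^+ 2 * (congestion P P' pi f * dform pi P phi).
  by rewrite /C; field; rewrite gt_eqF.
apply: ler_wpM2l; first exact: sqr_ge0.
by apply: dform_flow => //; [case: sP|case: sP'].
Qed.

Theorem theorem24 (R : realType) (n : nat) (P P' : 'M[R]_n) (pi : 'rV[R]_n)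
  (f : seq 'I_n -> R) (eps : R) (x : 'I_n) :
  ergodic P -> ergodic P' ->
  stationary P pi -> stationary P' pi ->
  is_flow P P' pi f ->
  0 < eps ->
  eps ^+ 2 * pi 0 x <= 1 ->
  cmix_time_x P pi eps x <=
    4 * congestion P P' pi f *
    ((cmix_time P' pi (2 * expR 1)^-1) ^+ 2 / (2^-1 - (2 * expR 1)^-1) ^+ 2) *
    ln ((eps ^+ 2 * pi 0 x)^-1)
  /\
  cmix_time_x P pi eps x <=
    4 * congestion P P' pi f *
    ((mix_time P' pi (2 * expR 1)^-1) ^+ 2 / (2^-1 - (2 * expR 1)^-1) ^+ 2) *
    ln ((eps ^+ 2 * pi 0 x)^-1).
Proof.
move=> ergP ergP' statP statP' flow eps0 eps1.
have k0 : 0 < 2^-1 - (2 * expR 1)^-1 :> R.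
  by rewrite invfM; have := expR1_inv_le R; lra.
split; apply: cmix_time_x_flow => // phi.
  exact: poincare_cmix_time.
exact: poincare_mix_time.
Qed.
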